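(* Let $a,b\in\mathbb O$ be nonzero octonions such that $\mathrm{Re}(a)=\mathrm{Re}(b)=0$ and $ab=-ba$. For $t\in\mathbb R$ put $$u(t)=\frac12+\frac{\sqrt3}{2\left\|a+\frac43\|a\|^2\,t\,b\right\|}\left(a+\frac43\|a\|^2\,t\,b\right),$$ and let $G_{a,b}^t\colon\mathbb O\to\mathbb O$ be the transformation $$G_{a,b}^t(x)=(u(t))^{-1}\Big(u(0)\Big(u(t)\Big((u(0))^{-1}\,x\,u(0)\Big)(u(t))^{-1}\Big)(u(0))^{-1}\Big)u(t).$$ Then the tangent vector to the curve $t\mapsto G_{a,b}^t$ in $G_2=\mathrm{Aut}(\mathbb O)$ at the identity (that is, at $t=0$) is $D_{a,b}$, where $D_{a,b}(x)=[[a,b],x]-3[a,b,x]$ for all $x\in\mathbb O$.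
   Context: $\mathbb O$ is the real algebra of octonions with real part $\mathrm{Re}$ and norm $\|\cdot\|$; $[x,y]=xy-yx$ is the commutator and $[x,y,z]=(xy)z-x(yz)$ the associator. $G_2=\mathrm{Aut}(\mathbb O)$ is the group of algebra automorphisms of $\mathbb O$. Expressions of the form $u\,x\,u^{-1}$ are unambiguous since any subalgebra of $\mathbb O$ generated by two elements is associative. Each $u(t)$ satisfies $\|u(t)\|=1$ and $u(t)^3\in\mathbb R$, and $G^t_{a,b}$ belongs to $G_2$ for all $t$, with $G^0_{a,b}$ the identity. Equivalently, $D_{a,b}=[L_a,L_b]+[L_a,R_b]+[R_a,R_b]$, where $L_a,R_a$ denote left and right multiplication by $a$. *)

(* Defs.v *)
From HB Require Import structures.
From mathcomp Require Import all_boot all_order all_algebra.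
From mathcomp Require Import all_classical all_reals all_analysis.
Import Order.TTheory GRing.Theory Num.Theory.
Import numFieldNormedType.Exports.

Set Implicit Arguments.
Unset Strict Implicit.
Unset Printing Implicit Defensive.

Local Open Scope ring_scope.

Section CayleyDickson.
Variables (R : comNzRingType) (n : nat).
Variables (mul : 'rV[R]_n -> 'rV[R]_n -> 'rV[R]_n) (conj : 'rV[R]_n -> 'rV[R]_n).

(* The doubled algebra has elements row_mx p q, standing for the pair (p, q),
   with (p, q)(r, s) = (pr - s^* q, sp + q r^* ) and (p, q)^* = (p^*, - q). *)
Definition cd_mul (x y : 'rV[R]_(n + n)) : 'rV[R]_(n + n) :=
  let p := lsubmx x in let q := rsubmx x in
  let r := lsubmx y in let s := rsubmx y in
  row_mx (mul p r - mul (conj s) q) (mul s p + mul q (conj r)).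

Definition cd_conj (x : 'rV[R]_(n + n)) : 'rV[R]_(n + n) :=
  row_mx (conj (lsubmx x)) (- rsubmx x).

End CayleyDickson.

Section Octonions.
Variable R : realType.

(* Three doublings of R; the doubled dimension 4 + 4 is convertible to 8. *)
Definition complex_mul := @cd_mul R 1 mulmx idfun.
Definition complex_conj := @cd_conj R 1 idfun.
Definition quaternion_mul := @cd_mul R 2 complex_mul complex_conj.
Definition quaternion_conj := @cd_conj R 2 complex_conj.

Definition octonion := 'rV[R]_8.

Definition omul : octonion -> octonion -> octonion :=
  @cd_mul R 4 quaternion_mul quaternion_conj.
Definition oconj : octonion -> octonion := @cd_conj R 4 quaternion_conj.

Definition oone : octonion := delta_mx 0 0.
Definition oRe (x : octonion) : R := x 0 0.
(* The Euclidean norm; `|x| on row vectors is the sup norm. *)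
Definition onorm (x : octonion) : R := Num.sqrt (oRe (omul x (oconj x))).
Definition oinv (x : octonion) : octonion := (onorm x ^+ 2)^-1 *: oconj x.

Definition ocomm (x y : octonion) : octonion := omul x y - omul y x.
Definition oassoc (x y z : octonion) : octonion :=
  omul (omul x y) z - omul x (omul y z).

Definition G2 (f : octonion -> octonion) : Prop :=
  [/\ linear f, bijective f & {morph f : x y / omul x y}].

Definition Dab (a b x : octonion) : octonion :=
  ocomm (ocomm a b) x - 3 *: oassoc a b x.

Section Curve.
Variables a b : octonion.

Definition uvec (t : R) : octonion := a + (4 / 3 * onorm a ^+ 2 * t) *: b.

Definition ucurve (t : R) : octonion :=
  (1 / 2) *: oone + (Num.sqrt 3 / (2 * onorm (uvec t))) *: uvec t.

Local Notation "x ∘ y" := (omul x y) (at level 40, left associativity).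

Definition Gab (t : R) (x : octonion) : octonion :=
  let u := ucurve t in let u0 := ucurve 0 in
  oinv u ∘ (u0 ∘ (u ∘ (oinv u0 ∘ x ∘ u0) ∘ oinv u) ∘ oinv u0) ∘ u.

End Curve.

(* The matrix of an R-linear endomorphism, which identifies End_R(O) with the
   finite-dimensional normed space 'M_8 in which G_2 lies; lin1_mx itself takes
   any function, and is only meaningful on linear ones. *)
Definition End_mx (f : octonion -> octonion) : 'M[R]_8 := lin1_mx f.

Definition tangent_vector_at (f : R -> octonion -> octonion) (t : R)
    (D : octonion -> octonion) : Prop :=
  linear D /\ is_derive t 1 (fun s => End_mx (f s)) (End_mx D).

End Octonions.

(* Main.v *)
Require Import Defs.
From mathcomp Require Import all_boot all_order all_algebra.
From mathcomp Require Import all_classical all_reals all_analysis.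
From mathcomp Require Import ring lra.
Import Order.TTheory GRing.Theory Num.Theory.
Import numFieldNormedType.Exports.
Local Open Scope ring_scope.

Set Implicit Arguments.
Unset Strict Implicit.
Unset Printing Implicit Defensive.

(* Write u(t) = 1/2 + v(t). Since v is imaginary of norm sqrt(3)/2, u is a
   primitive sixth root of unity: u^2 = u - 1, u^-1 = 1 - u and u^3 = -1. In an
   alternative algebra the Moufang identities give ((ux)u)(u^-1 y) = u(xy) and
   (xu)(u^-1 y u^-1) = (xy)u^-1; composing them, conjugation by u is
   multiplicative because u^3 is central, so G^t is in G_2.
   As a and b are orthogonal, the normalizing factor of u has derivative 0 at
   t = 0, so with r = sqrt(3)/(2|a|) one has v(0) = r a and w := u'(0) = b/r. Moufang
   and v^2 = -3/4 reduce the derivative of G^t at 0 to terms linear in v, w and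
   x, and the alternating property of the associator turns these into
   D_{v,w} = D_{a,b}. *)

Record alternative (R : nzRingType) n (mul : 'rV[R]_n -> 'rV[R]_n -> 'rV[R]_n)
    (e : 'rV[R]_n) : Prop := Alternative {
  altDl : forall x y z, mul (x + y) z = mul x z + mul y z;
  altDr : forall x y z, mul z (x + y) = mul z x + mul z y;
  altZl : forall k x y, mul (k *: x) y = k *: mul x y;
  altZr : forall k x y, mul x (k *: y) = k *: mul x y;
  alt1l : forall x, mul e x = x;
  alt1r : forall x, mul x e = x;
  altl : forall x y, mul x (mul x y) = mul (mul x x) y;
  altr : forall x y, mul (mul y x) x = mul y (mul x x) }.

Lemma alternative_op (R : nzRingType) n (mul : 'rV[R]_n -> 'rV[R]_n -> 'rV[R]_n) e :
  alternative mul e -> alternative (fun x y => mul y x) e.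
Proof. by case=> *; split. Qed.

Section Alternative.
Variables (R : realFieldType) (n : nat).
Variables (mul : 'rV[R]_n -> 'rV[R]_n -> 'rV[R]_n) (e : 'rV[R]_n).
Hypothesis alt : alternative mul e.
Implicit Types u v w x y z : 'rV[R]_n.
Local Notation "x ∘ y" := (mul x y) (at level 40, left associativity).

Lemma altNl x y : (- x) ∘ y = - (x ∘ y).
Proof. by rewrite -scaleN1r (altZl alt) scaleN1r. Qed.

Lemma altNr x y : x ∘ (- y) = - (x ∘ y).
Proof. by rewrite -scaleN1r (altZr alt) scaleN1r. Qed.

Lemma alt0l x : 0 ∘ x = 0.
Proof. by have := altZl alt 0 0 x; rewrite !scale0r. Qed.

Lemma alt0r x : x ∘ 0 = 0.
Proof. by have := altZr alt 0 x 0; rewrite !scale0r. Qed.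

Definition altE := (altDl alt, altDr alt, altNl, altNr, altZl alt, altZr alt,
  alt1l alt, alt1r alt).

Lemma altl_polar x y z : x ∘ (y ∘ z) + y ∘ (x ∘ z) = (x ∘ y) ∘ z + (y ∘ x) ∘ z.
Proof.
have := altl alt (x + y) z; rewrite !altE !(altl alt).
by move=> /rowP h; apply/rowP => i; have := h i; rewrite !mxE; lra.
Qed.

Lemma altr_polar x y z : z ∘ x ∘ y + z ∘ y ∘ x = z ∘ (x ∘ y) + z ∘ (y ∘ x).
Proof.
have := altr alt (x + y) z; rewrite !altE !(altr alt).
by move=> /rowP h; apply/rowP => i; have := h i; rewrite !mxE; lra.
Qed.

Lemma flexible x y : x ∘ y ∘ x = x ∘ (y ∘ x).
Proof. by have := altr_polar x y x; rewrite (altl alt) => /addrI. Qed.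

Lemma moufangl x y z : z ∘ (x ∘ (z ∘ y)) = z ∘ x ∘ z ∘ y.
Proof.
have h1 := altl_polar (z ∘ x) z y.
have h2 := altr_polar x (z ∘ y) z.
have h3 := altr_polar x y (z ∘ z).
have h4 := congr1 (mul z) (altr_polar x y z).
move: h1 h2 h3 h4; rewrite !altE !(altl alt) => /rowP h1 /rowP h2 /rowP h3 /rowP h4.
by apply/rowP => i; move: (h1 i) (h2 i) (h3 i) (h4 i); rewrite !mxE; lra.
Qed.

End Alternative.

Section Conjugation.
Variables (R : realFieldType) (n : nat).
Variables (mul : 'rV[R]_n -> 'rV[R]_n -> 'rV[R]_n) (e : 'rV[R]_n).
Hypothesis alt : alternative mul e.
Implicit Types u v w x y z : 'rV[R]_n.
Local Notation "x ∘ y" := (mul x y) (at level 40, left associativity).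
Let altE := altE alt.

Lemma moufangr x y z : y ∘ z ∘ x ∘ z = y ∘ (z ∘ (x ∘ z)).
Proof. exact: (moufangl (alternative_op alt)). Qed.

(* For a root [u] of [u^2 - u + 1 = 0], the inverse of [u] is [e - u]. *)
Definition conj_by u x := u ∘ x ∘ (e - u).

Lemma conj_byE u x : conj_by u x = u ∘ (x ∘ (e - u)).
Proof. by rewrite /conj_by !altE (flexible alt). Qed.

Lemma conj_by_linear u : linear (conj_by u).
Proof.
by move=> k x y; rewrite /conj_by; move: (e - u) => c; rewrite !altE.
Qed.

Lemma sixth_root_inv u : u ∘ u = u - e -> (e - u) ∘ (e - u) = e - u - e.
Proof.
by move=> uu; rewrite !altE uu; apply/rowP => i; rewrite !mxE; lra.
Qed.

Lemma mulKr_sixth_root u x : u ∘ u = u - e -> x ∘ u ∘ (e - u) = x.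
Proof.
by move=> uu; rewrite !altE (altr alt) uu !altE opprB addrC subrK.
Qed.

Lemma mulKl_sixth_root u x : u ∘ u = u - e -> u ∘ ((e - u) ∘ x) = x.
Proof.
by move=> uu; rewrite !altE (altl alt) uu !altE opprB addrC subrK.
Qed.

Lemma conj_byK u : u ∘ u = u - e -> cancel (conj_by u) (conj_by (e - u)).
Proof.
move=> uu x; rewrite /conj_by.
have vv := sixth_root_inv uu.
rewrite -/(conj_by u x) conj_byE -{2}[u](subKr e) (mulKl_sixth_root _ vv).
exact: mulKr_sixth_root.
Qed.

Lemma conj_byVK u : u ∘ u = u - e -> cancel (conj_by (e - u)) (conj_by u).
Proof.
by move=> uu x; rewrite -{1}[u](subKr e); apply/conj_byK/sixth_root_inv.
Qed.

Lemma conj_by_commutator u x : u ∘ u = u - e ->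
  conj_by (e - u) (conj_by u (conj_by u (conj_by (e - u) x))) = x.
Proof. by move=> uu; rewrite (conj_byVK uu) (conj_byK uu). Qed.

Lemma conj_byM u : u ∘ u = u - e -> {morph conj_by u : x y / x ∘ y}.
Proof.
move=> uu x y; set c := e - u.
have ux : conj_by u x = - (u ∘ x ∘ u ∘ u).
  by rewrite (altr alt) uu /conj_by -opprB (altNr alt).
have uy : conj_by u y = - (c ∘ (c ∘ y ∘ c)).
  have cc : c ∘ c = - u by rewrite (sixth_root_inv uu) addrAC subrr add0r.
  by rewrite (flexible alt) (altl alt) cc (altNl alt) opprK conj_byE.
rewrite ux uy !(altNl alt) !(altNr alt) opprK -moufangr (mulKr_sixth_root _ uu).
by rewrite -(moufangl alt) (mulKl_sixth_root _ uu).
Qed.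

Definition inner_der v w x :=
  (v ∘ w - w ∘ v) ∘ x - x ∘ (v ∘ w - w ∘ v) - 3 *: (v ∘ w ∘ x - v ∘ (w ∘ x)).

Lemma inner_der_linear v w : linear (inner_der v w).
Proof.
move=> k x y; rewrite /inner_der !altE.
by apply/rowP => i; rewrite !mxE; ring.
Qed.

Lemma inner_derZ k l v w x :
  inner_der (k *: v) (l *: w) x = (k * l) *: inner_der v w x.
Proof.
rewrite /inner_der !altE.
by apply/rowP => i; rewrite !mxE; ring.
Qed.

Lemma conj_by_comm_deriv v w x : v ∘ v = - (3 / 4) *: e -> v ∘ w = - (w ∘ v) ->
  let u := 2^-1 *: e + v in
  (- w ∘ conj_by u x) ∘ u +
  ((w ∘ conj_by (e - u) x) ∘ (e - u) + (u ∘ conj_by (e - u) x) ∘ - w) +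
  ((e - u) ∘ conj_by u x) ∘ w =
  inner_der v w x.
Proof.
move=> vv vw u; rewrite /inner_der /conj_by subKr.
have -> : e - u = 2^-1 *: e - v.
  by apply/rowP => i; rewrite !mxE; lra.
rewrite /u.
have h1 : w ∘ (v ∘ x ∘ v) ∘ v = - (3 / 4) *: (w ∘ v ∘ x).
  by rewrite (flexible alt) -moufangr (altr alt) vv !altE.
have h2 : v ∘ (v ∘ x ∘ v) ∘ w = - (3 / 4) *: (x ∘ v ∘ w).
  by rewrite (flexible alt) (altl alt) vv !altE.
rewrite !altE !scalerDr !(altE, scalerN) h1 h2.
have h3 := altl_polar alt v w x.
have h4 := altl_polar alt v x w.
have h5 := altr_polar alt v x w.
have h6 := altr_polar alt w x v.
move: h3 h4 h5 h6; rewrite vw !altE => /rowP h3 /rowP h4 /rowP h5 /rowP h6.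
apply/rowP => i; move: (h3 i) (h4 i) (h5 i) (h6 i); rewrite !mxE.
lra.
Qed.

End Conjugation.

Lemma cd_mul_row_mx (R : comNzRingType) n (mul : 'rV[R]_n -> 'rV[R]_n -> 'rV[R]_n)
    conj p q r s :
  cd_mul mul conj (row_mx p q) (row_mx r s) =
  row_mx (mul p r - mul (conj s) q) (mul s p + mul q (conj r)).
Proof. by rewrite /cd_mul !row_mxKl !row_mxKr. Qed.

Lemma cd_conj_row_mx (R : comNzRingType) n (conj : 'rV[R]_n -> 'rV[R]_n) p q :
  cd_conj conj (row_mx p q) = row_mx (conj p) (- q).
Proof. by rewrite /cd_conj row_mxKl row_mxKr. Qed.

Section Coordinates.
Variable R : realType.
Implicit Types a b c d : R.

Definition cplx a b : 'rV[R]_2 := row_mx (a%:M : 'rV_1) (b%:M : 'rV_1).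
Definition quat a b c d : 'rV[R]_4 := row_mx (cplx a b) (cplx c d).
Definition oct (a0 a1 a2 a3 a4 a5 a6 a7 : R) : octonion R :=
  row_mx (quat a0 a1 a2 a3) (quat a4 a5 a6 a7).

Lemma cplxD a b c d : cplx a b + cplx c d = cplx (a + c) (b + d).
Proof. by rewrite /cplx (@add_row_mx _ 1 1 1) -!raddfD. Qed.

Lemma cplxZ k a b : k *: cplx a b = cplx (k * a) (k * b).
Proof. by rewrite /cplx (@scale_row_mx _ 1 1 1) !scale_scalar_mx. Qed.

Lemma cplxN a b : - cplx a b = cplx (- a) (- b).
Proof. by rewrite /cplx (@opp_row_mx _ 1 1 1) -!raddfN. Qed.

Lemma complex_mulE a b c d :
  complex_mul (cplx a b) (cplx c d) = cplx (a * c - d * b) (d * a + b * c).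
Proof.
by rewrite /complex_mul /cplx cd_mul_row_mx /= -!scalar_mxM -raddfB -raddfD.
Qed.

Lemma complex_conjE a b : complex_conj (cplx a b) = cplx a (- b).
Proof. by rewrite /complex_conj /cplx cd_conj_row_mx -raddfN. Qed.

Lemma quatD a b c d a' b' c' d' :
  quat a b c d + quat a' b' c' d' = quat (a + a') (b + b') (c + c') (d + d').
Proof. by rewrite /quat (@add_row_mx _ 1 2 2) !cplxD. Qed.

Lemma quatZ k a b c d : k *: quat a b c d = quat (k * a) (k * b) (k * c) (k * d).
Proof. by rewrite /quat (@scale_row_mx _ 1 2 2) !cplxZ. Qed.

Lemma quatN a b c d : - quat a b c d = quat (- a) (- b) (- c) (- d).
Proof. by rewrite /quat (@opp_row_mx _ 1 2 2) !cplxN. Qed.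

Lemma quaternion_mulE a b c d a' b' c' d' :
  quaternion_mul (quat a b c d) (quat a' b' c' d') =
  quat (a * a' - b * b' - c * c' - d * d') (a * b' + b * a' + c * d' - d * c')
       (a * c' - b * d' + c * a' + d * b') (a * d' + b * c' - c * b' + d * a').
Proof.
rewrite /quaternion_mul /quat cd_mul_row_mx.
rewrite !(complex_conjE, complex_mulE, cplxN, cplxD).
congr (row_mx (cplx _ _) (cplx _ _)); ring.
Qed.

Lemma quaternion_conjE a b c d :
  quaternion_conj (quat a b c d) = quat a (- b) (- c) (- d).
Proof. by rewrite /quaternion_conj /quat cd_conj_row_mx complex_conjE cplxN. Qed.

Lemma octD a0 a1 a2 a3 a4 a5 a6 a7 b0 b1 b2 b3 b4 b5 b6 b7 :
  oct a0 a1 a2 a3 a4 a5 a6 a7 + oct b0 b1 b2 b3 b4 b5 b6 b7 =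
  oct (a0 + b0) (a1 + b1) (a2 + b2) (a3 + b3)
      (a4 + b4) (a5 + b5) (a6 + b6) (a7 + b7).
Proof. by rewrite /oct (@add_row_mx _ 1 4 4) !quatD. Qed.

Lemma octZ k a0 a1 a2 a3 a4 a5 a6 a7 :
  k *: oct a0 a1 a2 a3 a4 a5 a6 a7 =
  oct (k * a0) (k * a1) (k * a2) (k * a3) (k * a4) (k * a5) (k * a6) (k * a7).
Proof. by rewrite /oct (@scale_row_mx _ 1 4 4) !quatZ. Qed.

Lemma octN a0 a1 a2 a3 a4 a5 a6 a7 :
  - oct a0 a1 a2 a3 a4 a5 a6 a7 =
  oct (- a0) (- a1) (- a2) (- a3) (- a4) (- a5) (- a6) (- a7).
Proof. by rewrite /oct (@opp_row_mx _ 1 4 4) !quatN. Qed.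

Lemma omul_oct a0 a1 a2 a3 a4 a5 a6 a7 b0 b1 b2 b3 b4 b5 b6 b7 :
  omul (oct a0 a1 a2 a3 a4 a5 a6 a7) (oct b0 b1 b2 b3 b4 b5 b6 b7) =
  oct (a0 * b0 - a1 * b1 - a2 * b2 - a3 * b3
         - a4 * b4 - a5 * b5 - a6 * b6 - a7 * b7)
      (a0 * b1 + a1 * b0 + a2 * b3 - a3 * b2
         + a4 * b5 - a5 * b4 - a6 * b7 + a7 * b6)
      (a0 * b2 - a1 * b3 + a2 * b0 + a3 * b1
         + a4 * b6 + a5 * b7 - a6 * b4 - a7 * b5)
      (a0 * b3 + a1 * b2 - a2 * b1 + a3 * b0
         + a4 * b7 - a5 * b6 + a6 * b5 - a7 * b4)
      (a0 * b4 - a1 * b5 - a2 * b6 - a3 * b7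
         + a4 * b0 + a5 * b1 + a6 * b2 + a7 * b3)
      (a0 * b5 + a1 * b4 - a2 * b7 + a3 * b6
         - a4 * b1 + a5 * b0 - a6 * b3 + a7 * b2)
      (a0 * b6 + a1 * b7 + a2 * b4 - a3 * b5
         - a4 * b2 + a5 * b3 + a6 * b0 - a7 * b1)
      (a0 * b7 - a1 * b6 + a2 * b5 + a3 * b4
         - a4 * b3 - a5 * b2 + a6 * b1 + a7 * b0).
Proof.
rewrite /omul /oct cd_mul_row_mx.
rewrite !(quaternion_conjE, quaternion_mulE, quatN, quatD).
congr (row_mx (quat _ _ _ _) (quat _ _ _ _)); ring.
Qed.

Lemma oconj_oct a0 a1 a2 a3 a4 a5 a6 a7 :
  oconj (oct a0 a1 a2 a3 a4 a5 a6 a7) =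
  oct a0 (- a1) (- a2) (- a3) (- a4) (- a5) (- a6) (- a7).
Proof. by rewrite /oconj /oct cd_conj_row_mx quaternion_conjE quatN. Qed.

Lemma oRe_oct a0 a1 a2 a3 a4 a5 a6 a7 : oRe (oct a0 a1 a2 a3 a4 a5 a6 a7) = a0.
Proof.
have row0 n (p q : 'rV[R]_n.+1) : row_mx p q 0 0 = p 0 0.
  by rewrite -[RHS](row_mxEl p q); congr fun_of_matrix; apply/val_inj.
by rewrite /oRe /oct !(row0 3, row0 1, row0 0)%N [LHS]mxE.
Qed.

Lemma oone_oct : oone R = oct 1 0 0 0 0 0 0 0.
Proof.
have delta0 n : delta_mx 0 0 = row_mx (delta_mx 0 0) 0 :> 'rV[R]_(n.+1 + n.+1).
  by rewrite -delta_mx_lshift; congr delta_mx; apply/val_inj.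
have cplx0 : cplx 0 0 = 0 by rewrite /cplx raddf0 (@row_mx0 _ 1 1 1).
have quat0 : quat 0 0 0 0 = 0 by rewrite /quat cplx0 (@row_mx0 _ 1 2 2).
rewrite /oct quat0 /quat cplx0 /cplx raddf0 /oone (delta0 3) (delta0 1) (delta0 0)%N.
by rewrite [delta_mx 0 0]mx11_scalar mxE.
Qed.

Variant oct_spec : octonion R -> Prop :=
  OctSpec a0 a1 a2 a3 a4 a5 a6 a7 : oct_spec (oct a0 a1 a2 a3 a4 a5 a6 a7).

Lemma octP (x : octonion R) : oct_spec x.
Proof.
have h1 (y : 'rV[R]_(1 + 1)) : exists a b, y = cplx a b.
  by exists (lsubmx y 0 0), (rsubmx y 0 0); rewrite /cplx -!mx11_scalar hsubmxK.
have h2 (y : 'rV[R]_(2 + 2)) : exists a b c d, y = quat a b c d.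
  have [a [b ab]] := h1 (lsubmx y); have [c [d cd]] := h1 (rsubmx y).
  by exists a, b, c, d; rewrite /quat -ab -cd hsubmxK.
have [a0 [a1 [a2 [a3 xl]]]] := h2 (@lsubmx _ _ 4 4 x).
have [a4 [a5 [a6 [a7 xr]]]] := h2 (@rsubmx _ _ 4 4 x).
by rewrite -(@hsubmxK _ _ 4 4 x) xl xr.
Qed.

End Coordinates.

Lemma is_derive_mxP (R : realFieldType) (V : normedModType R) m n
    (M : V -> 'M[R]_(m, n)) t v dM :
  is_derive t v M dM <-> forall i j, is_derive t v (fun x => M x i j) (dM i j).
Proof.
split=> [[/[dup] Mtv /derivable_mxP Mtvij <-] i j|Mtv].
  by apply: DeriveDef => //; rewrite derive_mx // mxE.
have dMtv : derivable M t v by apply/derivable_mxP => i j; case: (Mtv i j).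
apply: DeriveDef => //; rewrite derive_mx //.
by apply/matrixP => i j; rewrite mxE; case: (Mtv i j).
Qed.

Section Bilinear.
Variables (R : realFieldType) (V : normedModType R) (n : nat).
Variable mul : 'rV[R]_n -> 'rV[R]_n -> 'rV[R]_n.
Hypothesis mulDl : forall x y z, mul (x + y) z = mul x z + mul y z.
Hypothesis mulDr : forall x y z, mul z (x + y) = mul z x + mul z y.
Hypothesis mulZl : forall k x y, mul (k *: x) y = k *: mul x y.
Hypothesis mulZr : forall k x y, mul x (k *: y) = k *: mul x y.

Lemma bilinear_sum_delta x y :
  mul x y = \sum_i \sum_j (x 0 i * y 0 j) *: mul (delta_mx 0 i) (delta_mx 0 j).
Proof.
have mul0l z : mul 0 z = 0 by have := mulZl 0 0 z; rewrite !scale0r.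
have mul0r z : mul z 0 = 0 by have := mulZr 0 z 0; rewrite !scale0r.
rewrite {1}(row_sum_delta x) (big_morph (mul^~ y) (fun u v => mulDl u v y) (mul0l y)).
apply: eq_bigr => i _; rewrite mulZl {1}(row_sum_delta y).
rewrite (big_morph (mul _) (fun u v => mulDr u v _) (mul0r _)) scaler_sumr.
by apply: eq_bigr => j _; rewrite mulZr scalerA.
Qed.

Lemma is_derive_bilinear (f g : V -> 'rV[R]_n) t v df dg :
  is_derive t v f df -> is_derive t v g dg ->
  is_derive t v (fun x => mul (f x) (g x)) (mul df (g t) + mul (f t) dg).
Proof.
move=> /is_derive_mxP fd /is_derive_mxP gd; apply/is_derive_mxP => k l.
rewrite (_ : (fun x => _) = \sum_i \sum_j
    (mul (delta_mx 0 i) (delta_mx 0 j) k l *: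
      ((fun x => f x 0 i) * (fun x => g x 0 j)))); last first.
  apply/funext => x; rewrite bilinear_sum_delta summxE fct_sumE; apply: eq_bigr => i _.
  rewrite summxE fct_sumE; apply: eq_bigr => j _.
  by rewrite mxE mulrC.
apply: is_derive_eq.
rewrite mxE (bilinear_sum_delta df) (bilinear_sum_delta _ dg) !summxE -big_split.
apply: eq_bigr => i _; rewrite !summxE -big_split.
apply: eq_bigr => j _; rewrite /= !mxE -mulrDl mulrC; congr (_ * _).
by rewrite addrC; congr (_ + _); rewrite mulrC.
Qed.

End Bilinear.

Lemma is_derive_normalized_line (R : realType) n (a b e : 'rV[R]_n) (p q k c : R) :
  0 < p ->
  is_derive (0 : R) 1
    (fun t => e + (c / (2 * Num.sqrt (p + q * t ^+ 2))) *: (a + (k * t) *: b))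
    ((c / (2 * Num.sqrt p) * k) *: b).
Proof.
move=> p0; apply/is_derive_mxP => i j.
have sq : is_derive (0 : R) 1 (fun t => Num.sqrt (p + q * t ^+ 2)) 0.
  have g : is_derive (0 : R) 1 (fun t => p + q * t ^+ 2) 0.
    have := is_deriveD (is_derive_cst p (0 : R) 1)
      (is_deriveZ q (is_deriveX 2 (is_derive_id (0 : R) (1 : R)))).
    by rewrite /= expr1 mulr0 scale0r scaler0 addr0.
  have h : is_derive (p + q * 0 ^+ 2) 1 Num.sqrt (2 * Num.sqrt (p + q * 0 ^+ 2))^-1.
    by apply: is_derive1_sqrt; rewrite expr0n mulr0 addr0.
  have := @is_derive1_comp R Num.sqrt (fun t => p + q * t ^+ 2) 0 _ _ h g.
  by rewrite mulr0.
have rho : is_derive (0 : R) 1 (fun t => (Num.sqrt (p + q * t ^+ 2))^-1) 0.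
  have nz : Num.sqrt (p + q * 0 ^+ 2) != 0.
    by rewrite expr0n mulr0 addr0 sqrtr_eq0 -ltNge.
  have := @is_deriveV R (fun t => Num.sqrt (p + q * t ^+ 2)) _ _ _ nz sq.
  by rewrite scaler0.
have := is_deriveD (is_derive_cst (e i j) (0 : R) 1) (is_deriveZ (c / 2) (is_deriveM rho
  (is_deriveD (is_derive_cst (a i j) (0 : R) 1)
    (is_deriveZ (k * b i j) (is_derive_id (0 : R) 1))))).
rewrite /= expr0n mulr0 addr0 scaler0 add0r addr0 add0r !mxE => h.
have -> : c / (2 * Num.sqrt p) * k * b i j =
    (c / 2) *: ((Num.sqrt p)^-1 *: ((k * b i j) *: 1)).
  by rewrite /GRing.scale /= invfM; ring.
rewrite (_ : (fun x : R => _) = cst (e i j) + c / 2 \*: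
  ((fun t => (Num.sqrt (p + q * t ^+ 2))^-1) *
   (cst (a i j) + (k * b i j \*: id)))) //.
apply/funext => t; rewrite !mxE.
transitivity (e i j + c / 2 * ((Num.sqrt (p + q * t ^+ 2))^-1 *
  (a i j + k * b i j * t))); last by [].
by rewrite invfM; ring.
Qed.

Section ConjugationDerivative.
Variables (R : realType) (n : nat).
Variables (mul : 'rV[R]_n -> 'rV[R]_n -> 'rV[R]_n) (e : 'rV[R]_n).
Hypothesis alt : alternative mul e.
Local Notation "x ∘ y" := (mul x y) (at level 40, left associativity).
Local Notation C := (conj_by mul e).

Lemma half_add_sqr v : v ∘ v = - (3 / 4) *: e ->
  let u := 2^-1 *: e + v in u ∘ u = u - e.
Proof.
move=> vv u; rewrite /u !(altE alt) vv.
by apply/rowP => i; rewrite !mxE; lra.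
Qed.

Lemma is_derive_conj_by_commutator (u : R -> 'rV[R]_n) (t : R) v w x :
    is_derive t 1 u w -> u t = 2^-1 *: e + v ->
    v ∘ v = - (3 / 4) *: e -> v ∘ w = - (w ∘ v) ->
  is_derive t 1 (fun s => C (e - u s) (C (u t) (C (u s) (C (e - u t) x))))
    (inner_der mul v w x).
Proof.
move=> du ut vv vw.
have uu : u t ∘ u t = u t - e by rewrite ut; apply: half_add_sqr.
have dmul (f g : R -> 'rV[R]_n) df dg : is_derive t 1 f df -> is_derive t 1 g dg ->
    is_derive t 1 (fun s => f s ∘ g s) (df ∘ g t + f t ∘ dg).
  exact: is_derive_bilinear (altDl alt) (altDr alt) (altZl alt) (altZr alt) _ _ _ _ _ _.
have dcst y : is_derive t 1 (fun=> y) (0 : 'rV[R]_n) by exact: is_derive_cst.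
have dc : is_derive t 1 (fun s => e - u s) (- w).
  by rewrite -[- w]sub0r; apply: is_deriveB.
have := dmul _ _ _ _ (dmul _ _ _ _ dc (dmul _ _ _ _ (dmul _ _ _ _ (dcst (u t))
  (dmul _ _ _ _ (dmul _ _ _ _ du (dcst (C (e - u t) x))) dc)) (dcst (e - u t)))) du.
set y := C _ x; set A := w ∘ y ∘ (e - u t) + u t ∘ y ∘ - w.
have uyc : u t ∘ y ∘ (e - u t) = x := conj_byVK alt uu x.
have cAu : (e - u t) ∘ (u t ∘ A ∘ (e - u t)) ∘ u t = A.
  by have := conj_byK alt uu A; rewrite /conj_by subKr.
rewrite uyc !(alt0l alt) !(alt0r alt) !addr0 !add0r (altDl alt) cAu.
rewrite -(conj_by_comm_deriv alt x vv vw) -ut.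
congr is_derive; apply/funext => s.
by rewrite [RHS]/conj_by subKr.
Qed.

End ConjugationDerivative.

Section Octonions.
Variable R : realType.
Implicit Types (a b u v x y : octonion R) (r s t : R).
Local Notation "x ∘ y" := (omul x y) (at level 40, left associativity).

Definition octE := (@omul_oct R, @octZ R, @octN R, @octD R, @oconj_oct R, @oone_oct R).

Lemma alternative_omul : alternative (@omul R) (oone R).
Proof.
split=> [x y z|x y z|k x y|k x y|x|x|x y|x y];
  case: (octP x) => x0 x1 x2 x3 x4 x5 x6 x7;
  try (case: (octP y) => y0 y1 y2 y3 y4 y5 y6 y7);
  try (case: (octP z) => z0 z1 z2 z3 z4 z5 z6 z7);
  rewrite !octE; congr oct; ring.
Qed.

Let alt := alternative_omul.

Lemma oconjE x : oconj x = (2 * oRe x) *: oone R - x.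
Proof.
case: (octP x) => x0 x1 x2 x3 x4 x5 x6 x7; rewrite oRe_oct !octE.
by congr oct; ring.
Qed.

Lemma omul_oconj x : x ∘ oconj x = onorm x ^+ 2 *: oone R.
Proof.
rewrite /onorm; case: (octP x) => x0 x1 x2 x3 x4 x5 x6 x7.
rewrite !octE oRe_oct sqr_sqrtr; last first.
  by rewrite !mulrN !opprK !addr_ge0 // sqr_ge0.
by congr oct; ring.
Qed.

Lemma onorm_gt0 x : x <> 0 -> 0 < onorm x.
Proof.
have oct0 : oct 0 0 0 0 0 0 0 0 = 0 :> octonion R.
  by have := octZ (0 : R) 0 0 0 0 0 0 0 0; rewrite scale0r !mul0r.
have sqrD_le0 (r s : R) : 0 <= s -> r ^+ 2 + s <= 0 -> r = 0 /\ s <= 0.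
  move=> s0 rs; have r0 := sqr_ge0 r; split; last by rewrite (le_trans _ rs) // lerDr.
  by apply/eqP; rewrite -sqrf_eq0 eq_le r0 andbT (le_trans _ rs) // lerDl.
move=> nz; rewrite lt_neqAle sqrtr_ge0 andbT eq_sym; apply/eqP; move: nz.
rewrite /onorm; case: (octP x) => x0 x1 x2 x3 x4 x5 x6 x7 nz.
move=> /eqP; rewrite sqrtr_eq0 !octE oRe_oct => h; apply: nz; rewrite -oct0.
move: h; rewrite (_ : _ - _ = x0 ^+ 2 + (x1 ^+ 2 + (x2 ^+ 2 + (x3 ^+ 2 +
  (x4 ^+ 2 + (x5 ^+ 2 + (x6 ^+ 2 + (x7 ^+ 2 + 0)))))))); last by ring.
by do 8 (case/sqrD_le0 => [|->]; first by rewrite ?addr_ge0 ?sqr_ge0).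
Qed.

Lemma oReD x y : oRe (x + y) = oRe x + oRe y.
Proof. by rewrite /oRe mxE. Qed.

Lemma oReN x : oRe (- x) = - oRe x.
Proof. by rewrite /oRe mxE. Qed.

Lemma oReZ r x : oRe (r *: x) = r * oRe x.
Proof. by rewrite /oRe mxE. Qed.

Lemma oRe_one : oRe (oone R) = 1.
Proof. by rewrite oone_oct oRe_oct. Qed.

Lemma sqr_imag v : oRe v = 0 -> v ∘ v = - onorm v ^+ 2 *: oone R.
Proof.
move=> v0; rewrite scaleNr -omul_oconj oconjE v0 mulr0 scale0r sub0r.
by rewrite (altNr alt) opprK.
Qed.

Lemma onorm_sqr_imag v : oRe v = 0 -> onorm v ^+ 2 = - oRe (v ∘ v).
Proof. by move=> /sqr_imag ->; rewrite oReZ oRe_one mulr1 opprK. Qed.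

(* [oinv] alone is ssrfun's option-valued inverse. *)
Lemma oinv_half_add v : oRe v = 0 -> v ∘ v = - (3 / 4) *: oone R ->
  let u := 2^-1 *: oone R + v in Defs.oinv u = oone R - u.
Proof.
move=> v0 vv u.
have cu : oconj u = oone R - u.
  by rewrite oconjE oReD oReZ oRe_one v0 mulr1 addr0 mulfV ?scale1r // pnatr_eq0.
have : onorm u ^+ 2 *: oone R = oone R.
  rewrite -omul_oconj cu !(altE alt) vv.
  by apply/rowP => i; rewrite !mxE; lra.
move=> /(congr1 (@oRe R)); rewrite oReZ oRe_one mulr1.
by rewrite /Defs.oinv cu => ->; rewrite invr1 scale1r.
Qed.

Lemma G2_comp (f g : octonion R -> octonion R) : G2 f -> G2 g -> G2 (f \o g).
Proof.
case=> fl fb fM [gl gb gM]; split.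
- by move=> k x y /=; rewrite gl fl.
- exact: bij_comp.
- by move=> x y /=; rewrite gM fM.
Qed.

Lemma G2_conj_by u : u ∘ u = u - oone R -> G2 (conj_by (@omul R) (oone R) u).
Proof.
move=> uu; split.
- exact: conj_by_linear.
- exists (conj_by (@omul R) (oone R) (oone R - u)); first exact: conj_byK.
  exact: conj_byVK.
- exact: conj_byM.
Qed.

Section Curve.
Variables a b : octonion R.
Hypotheses (ha : a <> 0) (hRea : oRe a = 0) (hReb : oRe b = 0).
Hypothesis hab : omul a b = - omul b a.

Let k : R := 4 / 3 * onorm a ^+ 2.

Lemma oRe_uvec t : oRe (uvec a b t) = 0.
Proof. by rewrite /uvec oReD oReZ hRea hReb mulr0 addr0. Qed.

Lemma onorm_uvec t :
  onorm (uvec a b t) = Num.sqrt (onorm a ^+ 2 + (k ^+ 2 * onorm b ^+ 2) * t ^+ 2).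
Proof.
rewrite -[LHS]ger0_norm ?sqrtr_ge0 // -sqrtr_sqr; congr Num.sqrt.
apply: (etrans (onorm_sqr_imag (oRe_uvec t))).
rewrite /uvec -/k !(altE alt) hab (sqr_imag hRea) (sqr_imag hReb).
(* Generalizing keeps unification from unfolding [omul] and [onorm]. *)
move: (b ∘ a) => ba; rewrite !(oReD, oReN, oReZ) oRe_one.
move: k (oRe ba) (onorm a) (onorm b) => l r p q; ring.
Qed.

Let v t : octonion R := (Num.sqrt 3 / (2 * onorm (uvec a b t))) *: uvec a b t.

Lemma ucurveE t : ucurve a b t = 2^-1 *: oone R + v t.
Proof. by rewrite /ucurve mul1r. Qed.

Lemma onorm_uvec_gt0 t : 0 < onorm (uvec a b t).
Proof.
rewrite onorm_uvec sqrtr_gt0 ltr_wpDr ?exprn_gt0 ?onorm_gt0 //.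
by rewrite -!exprMn sqr_ge0.
Qed.

Lemma oRe_v t : oRe (v t) = 0.
Proof. by rewrite oReZ oRe_uvec mulr0. Qed.

Lemma sqr_v t : v t ∘ v t = - (3 / 4) *: oone R.
Proof.
rewrite (altZl alt) (altZr alt) (sqr_imag (oRe_uvec t)) !scalerA; congr (_ *: _).
have := onorm_uvec_gt0 t; move: (onorm _) => m m0.
have s3 : Num.sqrt 3 ^+ 2 = 3 :> R by rewrite sqr_sqrtr ?ler0n.
rewrite -[X in X / 4]s3; field.
by rewrite gt_eqF.
Qed.

Lemma sqr_ucurve t : ucurve a b t ∘ ucurve a b t = ucurve a b t - oone R.
Proof. by rewrite ucurveE; apply: (half_add_sqr alt); apply: sqr_v. Qed.

Lemma oinv_ucurve t : Defs.oinv (ucurve a b t) = oone R - ucurve a b t.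
Proof.
by rewrite ucurveE; apply: oinv_half_add; [apply: oRe_v|apply: sqr_v].
Qed.

Local Notation C := (conj_by (@omul R) (oone R)).

Lemma GabE t x : Gab a b t x =
  C (oone R - ucurve a b t) (C (ucurve a b 0) (C (ucurve a b t)
    (C (oone R - ucurve a b 0) x))).
Proof. by rewrite /Gab !oinv_ucurve /conj_by !subKr. Qed.

Lemma G2_Gab t : G2 (Gab a b t).
Proof.
have -> : Gab a b t = C (oone R - ucurve a b t) \o (C (ucurve a b 0) \o
    (C (ucurve a b t) \o C (oone R - ucurve a b 0))).
  by apply/funext => x; rewrite GabE.
have uu s := sixth_root_inv alt (sqr_ucurve s).
by do !apply: G2_comp; apply: G2_conj_by; rewrite ?uu ?sqr_ucurve.
Qed.

Lemma Gab0 x : Gab a b 0 x = x.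
Proof. exact: etrans (GabE 0 x) (conj_by_commutator alt x (sqr_ucurve 0)). Qed.

Lemma is_derive_ucurve :
  is_derive (0 : R) 1 (ucurve a b) ((Num.sqrt 3 / (2 * onorm a))^-1 *: b).
Proof.
have a0 := onorm_gt0 ha.
have := @is_derive_normalized_line R 8 a b (2^-1 *: oone R) _ (k ^+ 2 * onorm b ^+ 2) k
  (Num.sqrt 3) (exprn_gt0 2 a0).
rewrite sqrtr_sqr gtr0_norm //.
have -> : Num.sqrt 3 / (2 * onorm a) * k = (Num.sqrt 3 / (2 * onorm a))^-1.
  rewrite /k; move: (onorm a) a0 => p p0.
  have s3 : Num.sqrt 3 ^+ 2 = 3 :> R by rewrite sqr_sqrtr ?ler0n.
  have s30 : Num.sqrt 3 != 0 :> R by rewrite sqrtr_eq0 -ltNge.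
  rewrite -[X in 4 / X]s3; field.
  by rewrite s30 gt_eqF.
congr is_derive; apply/funext => t.
by rewrite ucurveE /v onorm_uvec /uvec -/k.
Qed.

Lemma is_derive_Gab x : is_derive (0 : R) 1 (fun t => Gab a b t x) (Dab a b x).
Proof.
set r := Num.sqrt 3 / (2 * onorm a).
have uvec0 : uvec a b 0 = a by rewrite /uvec mulr0 scale0r addr0.
have v0 : v 0 = r *: a by rewrite /v uvec0.
have r0 : r != 0.
  by rewrite gt_eqF // divr_gt0 ?sqrtr_gt0 // mulr_gt0 // onorm_gt0.
have vw : v 0 ∘ (r^-1 *: b) = - ((r^-1 *: b) ∘ v 0).
  rewrite v0 !(altZl alt) !(altZr alt) hab.
  by move: (b ∘ a) => ba; rewrite !scalerN !scalerA mulrC.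
have -> : Dab a b x = inner_der (@omul R) (v 0) (r^-1 *: b) x.
  by rewrite v0 (inner_derZ alt) mulfV // scale1r.
have -> : (fun t => Gab a b t x) = (fun t => C (oone R - ucurve a b t)
    (C (ucurve a b 0) (C (ucurve a b t) (C (oone R - ucurve a b 0) x)))).
  by apply/funext => t; apply: GabE.
have h := is_derive_conj_by_commutator alt x is_derive_ucurve (ucurveE 0) (sqr_v 0) vw.
exact: h.
Qed.

Lemma Dab_linear : linear (Dab a b).
Proof. exact: (inner_der_linear alt). Qed.

Lemma tangent_vector_Gab : tangent_vector_at (Gab a b) 0 (Dab a b).
Proof.
split; first exact: Dab_linear.
apply/is_derive_mxP => i j.
have /is_derive_mxP/(_ 0 j) := is_derive_Gab (delta_mx 0 i).
rewrite [End_mx (Dab a b) i j]mxE.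
congr is_derive; apply/funext => s.
by rewrite [RHS]mxE.
Qed.

End Curve.
End Octonions.

Theorem lemma3 (R : realType) (a b : octonion R)
    (ha : a <> 0) (hb : b <> 0) (hRea : oRe a = 0) (hReb : oRe b = 0)
    (hab : omul a b = - omul b a) :
  [/\ forall t : R, G2 (Gab a b t),
      forall x : octonion R, Gab a b 0 x = x
    & tangent_vector_at (Gab a b) 0 (Dab a b)].
Proof.
split; [exact: G2_Gab|exact: Gab0|exact: tangent_vector_Gab].
Qed.
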